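(* Let $\Omega$ be a finite set of size $n$ and $1\le r\le n$. The (non-empty) poset $(\mathrm{Dom}(r,\Omega),\leqslant)$ of domination completions of $\mathcal{U}_{r,\Omega}$ has a unique minimal element if and only if $\mathcal{U}_{r,\Omega}$ is a domination hypergraph.
   Context: Graphs are finite, simple, undirected; $\mathcal{D}(G)$ is the family of inclusion-minimal dominating sets of $G$ (a dominating set is $D\subseteq V(G)$ such that every vertex outside $D$ has a neighbour in $D$). A hypergraph on $\Omega$ is a nonempty family of nonempty subsets of $\Omega$, none a proper subset of another; it has ground set $\Omega$ if the union of its members is $\Omega$. A domination hypergraph is one of the form $\mathcal{D}(G)$ for a graph $G$. $\mathcal{U}_{r,\Omega}=\{A\subseteq\Omega:|A|=r\}$. For hypergraphs $\mathcal{H}_1,\mathcal{H}_2$ on $\Omega$, $\mathcal{H}_1\leqslant\mathcal{H}_2$ means: for every $A_1\in\mathcal{H}_1$ there is $A_2\in\mathcal{H}_2$ with $A_2\subseteq A_1$ (a partial order). $\mathrm{Dom}(r,\Omega)$ is the set of domination hypergraphs $\mathcal{H}$ with ground set $\Omega$ such that $\mathcal{U}_{r,\Omega}\leqslant\mathcal{H}$ (domination completions). *)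

(* Defs.v *)
From mathcomp Require Import all_boot.

Set Implicit Arguments.
Unset Strict Implicit.
Unset Printing Implicit Defensive.

(* Simple graphs whose vertex set is a subset of [T], not necessarily the
   whole of [T]: a family of subsets of [T] may a priori be of the form D(G)
   for a graph G on fewer vertices. *)
Record sgraph (T : finType) := SGraph {
  verts : {set T};
  adj : rel T;
  adj_sym : symmetric adj;
  adj_irr : irreflexive adj;
  adj_verts : forall x y, adj x y -> (x \in verts) && (y \in verts)
}.

Section Domination.
Variable T : finType.
Implicit Types (G : sgraph T) (D A B : {set T}) (H K : {set {set T}}).

Definition dominating G D : bool :=
  (D \subset verts G) && [forall x in verts G :\: D, exists y in D, adj G x y].

Definition min_dom_sets G : {set {set T}} :=
  [set D : {set T} | minset (dominating G) D].

Definition hypergraph H : Prop :=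
  [/\ H != set0, set0 \notin H
    & forall A B, A \in H -> B \in H -> ~~ (A \proper B)].

Definition has_full_ground H : Prop := cover H = [set: T].

Definition domination_hypergraph H : Prop :=
  hypergraph H /\ exists G, H = min_dom_sets G.

Definition hyp_le H K : Prop :=
  forall A, A \in H -> exists2 B, B \in K & B \subset A.

Definition minimal_for (P : {set {set T}} -> Prop) H : Prop :=
  P H /\ forall K, P K -> hyp_le K H -> K = H.

End Domination.

Definition uniform_hyp (T : finType) (r : nat) : {set {set T}} :=
  [set A : {set T} | #|A| == r].

Definition domination_completion (T : finType) (r : nat)
    (H : {set {set T}}) : Prop :=
  [/\ domination_hypergraph H, has_full_ground H & hyp_le (uniform_hyp T r) H].

(* Main.v *)
Require Import Defs.
From mathcomp Require Import all_boot.

(** A graph on [T] gives a completion of [U_r] exactly when every vertex has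
    fewer than [r] non-neighbours. If [#|A| < r] and [x \notin A], this holds
    for the graph whose only non-edges join [x] to [A], and there [A] does not
    dominate [x]. A unique minimal completion lies below all completions, so
    each of its members dominates every such graph and has at least [r]
    elements; hence it is [U_r] itself. *)

Set Implicit Arguments.
Unset Strict Implicit.
Unset Printing Implicit Defensive.

(** * The order on hypergraphs and descent to minimal elements *)

Section HypergraphOrder.
Variable T : finType.
Implicit Types (H K M : {set {set T}}) (A B : {set T}).

Lemma hyp_le_refl H : hyp_le H H.
Proof. by move=> A AH; exists A. Qed.

Lemma hyp_le_trans H K M : hyp_le H K -> hyp_le K M -> hyp_le H M.
Proof.
move=> leHK leKM A /leHK[B /leKM[C CM sCB] sBA].
by exists C; last exact: subset_trans sCB sBA.
Qed.

(** A member [A] of [H] contains some [B] in [K], which contains some [C] in [H]. The antichain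
    property gives [C = A], so [A = B]. *)
Lemma hyp_le_subset H K : hypergraph H -> hyp_le H K -> hyp_le K H ->
  H \subset K.
Proof.
case=> _ _ antiH leHK leKH; apply/subsetP=> A AH.
have [B BK sBA] := leHK A AH; have [C CH sCB] := leKH B BK.
have sCA := subset_trans sCB sBA.
have eCA : C = A.
  apply/eqP; rewrite eqEsubset sCA /=; apply: contraT => nsAC.
  by have := antiH C A CH AH; rewrite properE sCA nsAC.
suff -> : A = B by [].
by apply/eqP; rewrite eqEsubset sBA -{1}eCA sCB.
Qed.

Lemma hyp_le_anti H K : hypergraph H -> hypergraph K ->
  hyp_le H K -> hyp_le K H -> H = K.
Proof.
move=> hH hK leHK leKH.
by apply/eqP; rewrite eqEsubset !hyp_le_subset.
Qed.

(** Turns [hyp_le] into inclusion of finite sets, so that the cardinality of the up-closure is a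
    measure for descending induction. *)
Definition up_closure H : {set {set T}} :=
  [set B : {set T} | [exists A in H, A \subset B]].

Lemma hyp_leP H K : hyp_le H K <-> up_closure H \subset up_closure K.
Proof.
split=> [leHK | /subsetP sHK A AH].
  apply/subsetP=> C; rewrite !inE => /exists_inP[A /leHK[B BK sBA] sAC].
  by apply/exists_inP; exists B; last exact: subset_trans sBA sAC.
have /sHK : A \in up_closure H by rewrite inE; apply/exists_inP; exists A.
by rewrite inE => /exists_inP[B BK sBA]; exists B.
Qed.

(* The double negation keeps the statement constructive: [P] is an arbitrary
   proposition, and the only use below is to prove a boolean. *)
Lemma minimal_for_below (P : {set {set T}} -> Prop) K :
  (forall H, P H -> hypergraph H) -> P K ->
  ~ ~ exists2 M, minimal_for P M & hyp_le M K.
Proof.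
move=> hP; have [m] := ubnP #|up_closure K|.
elim: m K => // m IHm K ltKm PK noM.
apply: (noM); exists K; last exact: hyp_le_refl.
split=> // L PL leLK; apply/eqP; apply: contraT => neLK; exfalso.
have ltLK : #|up_closure L| < #|up_closure K|.
  apply: proper_card; rewrite properE; have /hyp_leP -> := leLK.
  apply: contra neLK => /hyp_leP leKL.
  by apply/eqP; apply: hyp_le_anti => //; exact: hP.
apply: (IHm L) => //; first exact: leq_trans ltLK _.
case=> M minM leML; apply: noM; exists M => //.
exact: hyp_le_trans leML leLK.
Qed.

End HypergraphOrder.

(** * Minimal dominating sets and a degree criterion for completions *)

Section MinimalDominatingSets.
Variable T : finType.
Implicit Types (G : sgraph T) (D I A : {set T}).

Lemma dominatingP G D :
  reflect (D \subset verts G /\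
           forall x, x \in verts G -> x \notin D -> exists2 y, y \in D & adj G x y)
          (dominating G D).
Proof.
apply: (iffP andP) => -[sDV domD]; split=> //.
  move=> x xV xD; have /exists_inP// : [exists y in D, adj G x y].
  by apply: (forall_inP domD); rewrite inE xD.
apply/forall_inP=> x; rewrite inE => /andP[xD xV].
by apply/exists_inP; exact: domD.
Qed.

Lemma dominating_verts G : dominating G (verts G).
Proof. by apply/dominatingP; split=> // x ->. Qed.

Lemma dominatingS G D A :
  dominating G D -> D \subset A -> A \subset verts G -> dominating G A.
Proof.
move=> /dominatingP[_ domD] sDA sAV; apply/dominatingP; split=> // x xV xA.
have [|y yD adjxy] := domD x xV; first by apply: contra xA; apply: (subsetP sDA).
by exists y; first exact: (subsetP sDA).
Qed.

Lemma min_dom_sets_below G A :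
  dominating G A -> exists2 D, D \in min_dom_sets G & D \subset A.
Proof.
by move=> /minset_exists[D minD sDA]; exists D; rewrite ?inE.
Qed.

Definition independent G I : bool :=
  (I \subset verts G) && [forall x in I, forall y in I, ~~ adj G x y].

Lemma independentP G I :
  reflect (I \subset verts G /\ {in I &, forall x y, ~~ adj G x y})
          (independent G I).
Proof.
apply: (iffP andP) => -[sIV indI]; split=> //.
  by move=> x y xI yI; apply: (forall_inP (forall_inP indI x xI)).
by apply/forall_inP=> x xI; apply/forall_inP=> y; exact: indI.
Qed.

(** A vertex with no neighbour in [I] could be added to [I], so maximality gives domination. A
    vertex of [I] has no neighbour in [I], so it cannot be dropped. *)
Lemma maximal_independent_min_dom G I :
  maxset (independent G) I -> I \in min_dom_sets G.
Proof.
case/maxsetP=> /independentP[sIV indI] maxI.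
rewrite inE; apply/minsetP; split.
  apply/dominatingP; split=> // x xV xI; apply/exists_inP.
  apply: contraNT xI => noadj; rewrite -(maxI (x |: I)) ?setU11 ?subsetUr //.
  have nadj y : y \in I -> ~~ adj G x y.
    by move=> yI; apply: contra noadj => adjxy; apply/exists_inP; exists y.
  apply/independentP; split; first by rewrite subUset sub1set xV.
  move=> y z /setU1P[->|yI] /setU1P[->|zI]; first by rewrite adj_irr.
  - exact: nadj.
  - by rewrite adj_sym nadj.
  - exact: indI.
move=> D /dominatingP[_ domD] sDI; apply/eqP; rewrite eqEsubset sDI /=.
apply/subsetP=> x xI; apply: contraT => xD.
have [y yD adjxy] := domD x (subsetP sIV x xI) xD.
by have := indI x y xI (subsetP sDI y yD); rewrite adjxy.
Qed.

(** Every singleton of a vertex is independent, hence extends to a maximal independent set, which is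
    a minimal dominating set. *)
Lemma cover_min_dom_sets G : cover (min_dom_sets G) = verts G.
Proof.
apply/setP=> x; apply/bigcupP/idP=> [[D] | xV].
  by rewrite inE => /minsetp/dominatingP[/subsetP sDV _] /sDV.
have ind1 : independent G [set x].
  apply/independentP; split; first by rewrite sub1set.
  by move=> y z /set1P-> /set1P->; rewrite adj_irr.
have [I maxI] := maxset_exists ind1; rewrite sub1set => xI.
by exists I => //; exact: maximal_independent_min_dom.
Qed.

(** For the graph without vertices the only minimal dominating set is empty, which a hypergraph
    forbids. *)
Lemma hypergraph_min_dom_sets G :
  verts G != set0 -> hypergraph (min_dom_sets G).
Proof.
case/set0Pn=> x xV; split.
- have [D DG _] := min_dom_sets_below (dominating_verts G).
  by apply/set0Pn; exists D.
- rewrite inE; apply/negP=> /minsetp/dominatingP[_ /(_ x xV)].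
  by rewrite inE => /(_ isT)[y]; rewrite inE.
- move=> A B; rewrite !inE => /minsetp domA /minsetP[_ minB].
  by apply/negP; rewrite properEneq => /andP[/eqP neAB /(minB A domA)].
Qed.

Definition non_neighbours G (x : T) : {set T} :=
  [set y | (y != x) && ~~ adj G x y].

(** A set of size [r] that misses [x] is too large to consist of non-neighbours of [x]. Hence every
    set of size [r] is dominating and contains a minimal dominating set. *)
Lemma domination_completion_min_dom_sets G r :
  0 < #|T| -> verts G = setT -> (forall x, #|non_neighbours G x| < r) ->
  domination_completion r (min_dom_sets G).
Proof.
move=> T_gt0 VT ltr; split.
- split; last by exists G.
  by apply: hypergraph_min_dom_sets; rewrite VT -card_gt0 cardsT.
- by rewrite /has_full_ground cover_min_dom_sets.
- move=> A; rewrite inE => /eqP cardA; apply: min_dom_sets_below.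
  apply/dominatingP; split=> [|x _ xA]; first by rewrite VT subsetT.
  apply/exists_inP; apply: contraT => noadj.
  have /subset_leq_card : A \subset non_neighbours G x.
    apply/subsetP=> y yA; rewrite inE; apply/andP; split.
      by apply: contraNneq xA => <-.
    by apply: contra noadj => adjxy; apply/exists_inP; exists y.
  by rewrite cardA leqNgt ltr.
Qed.

End MinimalDominatingSets.

(** * Complements of stars *)

Section CoStar.
Variables (T : finType) (x : T) (A : {set T}).

(** For [x] outside [A], the complement of the star with centre [x] and leaves [A]. *)
Definition costar_adj : rel T := fun u v =>
  [&& u != v, ~~ ((u == x) && (v \in A)) & ~~ ((v == x) && (u \in A))].

Lemma costar_adj_sym : symmetric costar_adj.
Proof. by move=> u v; rewrite /costar_adj eq_sym; congr (_ && _); exact: andbC. Qed.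

Lemma costar_adj_irr : irreflexive costar_adj.
Proof. by move=> u; rewrite /costar_adj eqxx. Qed.

Lemma costar_adj_verts u v :
  costar_adj u v -> (u \in [set: T]) && (v \in [set: T]).
Proof. by rewrite !inE. Qed.

Definition costar : sgraph T :=
  SGraph costar_adj_sym costar_adj_irr costar_adj_verts.

Hypothesis xA : x \notin A.

Lemma costar_not_dominating : ~~ dominating costar A.
Proof.
apply/negP=> /dominatingP[_ /(_ x (in_setT x) xA)[y yA]].
by rewrite /= /costar_adj eqxx yA andbF.
Qed.

Lemma card_costar_non_neighbours r u :
  #|A| < r -> #|non_neighbours costar u| < r.
Proof.
move=> ltAr; have [->|neux] := eqVneq u x.
  apply: leq_ltn_trans ltAr; apply/subset_leq_card/subsetP=> v.
  rewrite inE /= /costar_adj eqxx eq_sym (negPf xA) andbF andbT.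
  by case/andP=> ->; rewrite negbK.
(* A vertex outside [x |: A] has no non-neighbours; a vertex of [A] has at most [x]. *)
have [uA|uA] := boolP (u \in A); last first.
  apply: leq_ltn_trans ltAr; apply/subset_leq_card/subsetP=> v.
  by rewrite inE /= /costar_adj eq_sym (negPf neux) (negPf uA) !andbF !andbT andbN.
(* Since [A] contains [u], it has at least one element, so a bound of one non-neighbour suffices. *)
have ltr : 1 < r by apply: leq_ltn_trans ltAr; apply/card_gt0P; exists u.
apply: leq_ltn_trans ltr; rewrite -(cards1 x).
apply/subset_leq_card/subsetP=> v.
rewrite !inE /= /costar_adj eq_sym (negPf neux) uA andbT /=.
by case/andP=> ->; rewrite negbK.
Qed.

Lemma domination_completion_costar r :
  #|A| < r -> domination_completion r (min_dom_sets costar).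
Proof.
move=> ltAr; apply: domination_completion_min_dom_sets => // [|u].
  by apply/card_gt0P; exists x.
exact: card_costar_non_neighbours.
Qed.

End CoStar.

Lemma exists_subset_card (T : finType) (A : {set T}) r :
  r <= #|A| -> exists2 B : {set T}, B \subset A & #|B| = r.
Proof.
case/card_geqP=> s [uniq_s <- sA]; exists [set y in s].
  by apply/subsetP=> y; rewrite inE => /sA.
by rewrite cardsE; apply/card_uniqP.
Qed.

(** * The uniform hypergraph and its completions *)

Section UniformHypergraph.
Variables (T : finType) (r : nat).
Hypotheses (r_gt0 : 0 < r) (r_le_T : r <= #|T|).

Lemma hypergraph_uniform : hypergraph (uniform_hyp T r).
Proof.
split.
- have [|A _ cA] := @exists_subset_card T setT r; first by rewrite cardsT.
  by apply/set0Pn; exists A; rewrite inE cA.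
- by rewrite inE cards0 eq_sym -lt0n.
- move=> A B; rewrite !inE => /eqP cA /eqP cB.
  by apply/negP=> /proper_card; rewrite cA cB ltnn.
Qed.

Lemma has_full_ground_uniform : has_full_ground (uniform_hyp T r).
Proof.
apply/setP=> x; rewrite [RHS]inE; apply/bigcupP.
(* Adding [x] to [r.-1] other points gives a member that contains [x]. *)
have [|B sBx cB] := @exists_subset_card T [set~ x] r.-1.
  by rewrite -ltnS prednK // cardsC1 prednK // (leq_trans r_gt0).
have xB : x \notin B by apply/negP=> /(subsetP sBx); rewrite !inE eqxx.
by exists (x |: B); rewrite ?setU11 // inE cardsU1 xB cB add1n prednK.
Qed.

(** Every completion lies above the uniform hypergraph by definition. If the latter is itself a
    completion, it is the least one, hence the only minimal one. *)
Lemma minimal_completion_uniform :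
  domination_hypergraph (uniform_hyp T r) ->
  exists! H : {set {set T}}, minimal_for (@domination_completion T r) H.
Proof.
move=> domU.
have complU : domination_completion r (uniform_hyp T r).
  by split=> //; [exact: has_full_ground_uniform | exact: hyp_le_refl].
exists (uniform_hyp T r); split.
  split=> // K [[hK _] _ leUK] leKU.
  by apply: hyp_le_anti => //; exact: hypergraph_uniform.
by move=> H [[_ _ leUH] minH]; exact: minH.
Qed.

Lemma unique_minimal_completion (H : {set {set T}}) :
  unique (minimal_for (@domination_completion T r)) H -> H = uniform_hyp T r.
Proof.
move=> [[[[hH _] _ leUH] _] uniqH].
apply: hyp_le_anti => //; first exact: hypergraph_uniform.
move=> A AH; suff /exists_subset_card[B sBA cB] : r <= #|A|.
  by exists B; rewrite ?inE ?cB.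
rewrite leqNgt; apply/negP=> ltAr.
(* A point outside [A] exists because [#|A| < r <= #|T|]. *)
have /set0Pn[x] : ~: A != set0.
  by rewrite -card_gt0 cardsCs setCK subn_gt0 (leq_trans ltAr).
rewrite inE => xA.
(* The goal is [False], so the doubly negated existence can be used. The minimal completion below
   the co-star hypergraph is [H] by uniqueness, so [A] contains a dominating set of the co-star and
   dominates it too, a contradiction. *)
have := @minimal_for_below _ _ (min_dom_sets (costar x A)) _
          (domination_completion_costar xA ltAr).
apply=> [K [[]] // | [M /uniqH <- /(_ A AH)[D]]].
rewrite inE => /minsetp domD sDA; have /negP := costar_not_dominating xA; apply.
exact: dominatingS domD sDA (subsetT A).
Qed.

Lemma domination_completion_exists :
  exists H : {set {set T}}, domination_completion r H.
Proof.
have /card_gt0P[x _] := leq_trans r_gt0 r_le_T.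
(* With no leaves the co-star is the complete graph on [T]. *)
exists (min_dom_sets (costar x set0)).
by apply: domination_completion_costar; rewrite ?inE // cards0.
Qed.

End UniformHypergraph.

Theorem theorem3p4 (T : finType) (n r : nat) (cardT : #|T| = n)
    (r_gt0 : 1 <= r) (r_le_n : r <= n) :
  (exists H : {set {set T}}, domination_completion r H) /\
  ((exists! H : {set {set T}}, minimal_for (@domination_completion T r) H) <->
   domination_hypergraph (uniform_hyp T r)).
Proof.
subst n; split; first exact: domination_completion_exists.
split=> [[H uniqH] | ]; last exact: minimal_completion_uniform.
rewrite -(unique_minimal_completion r_gt0 r_le_n uniqH).
by case: uniqH => -[[]].
Qed.
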